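(* Fix an integer $k\ge 2$. For each $n\in\mathbb{N}$, let $J_{k,n}$ be the number of subsets of $\{1,2,\ldots,n\}$ that (1) satisfy the $k$-Zeckendorf condition, (2) contain $n$, and (3) are maximal. Then $$J_{k,n}=\begin{cases}1, & \text{if } n=1;\\ 0, & \text{if } 2\le n\le k+1;\\ 1, & \text{if } k+1<n\le 2k+2;\\ J_{k,n-1}+J_{k,n-(k+1)}, & \text{if } n>2k+2.\end{cases}$$
   Context: $\mathbb{N}=\{1,2,3,\ldots\}$. A nonempty finite set $S\subseteq\mathbb{N}$ is maximal if $\min S=|S|$ (this is a cardinality condition, not maximality under inclusion). A finite set of natural numbers satisfies the $k$-Zeckendorf condition if any two distinct numbers in the set are at least $k$ apart (singletons satisfy this vacuously). *)

(* Defs.v *)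
From mathcomp Require Import all_boot all_order all_algebra.
From mathcomp Require Import finmap.

Set Implicit Arguments.
Unset Strict Implicit.
Unset Printing Implicit Defensive.

Local Open Scope fset_scope.
Local Open Scope nat_scope.

(* The starting value [head 0 S] is itself a member of a nonempty [S], so it
   does not affect the minimum; the convention is [fset_min fset0 = 0]. *)
Definition fset_min (S : {fset nat}) : nat :=
  \big[minn/head 0 S]_(x <- S) x.

Lemma fset_minP (S : {fset nat}) : S != fset0 ->
  fset_min S \in S /\ (forall x, x \in S -> fset_min S <= x).
Proof.
move=> S0; rewrite /fset_min; split; last first.
  move=> x; rewrite -[x \in S]/(x \in enum_fset S).
  elim: (enum_fset S) (head 0 _) => //= y s IH d.
  rewrite inE big_cons => /orP[/eqP->|/IH h]; first exact: geq_minl.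
  exact: leq_trans (geq_minr _ _) (h d).
have hS : head 0 S \in S.
  have [y yS] := fset0Pn _ S0.
  have: y \in enum_fset S by [].
  have: forall z, z \in enum_fset S -> z \in S by [].
  by case: (enum_fset S) => //= z s + _; apply; rewrite mem_head.
rewrite big_seq; elim/big_ind: _ => // x y hx hy.
by rewrite /minn; case: ifP.
Qed.

(* Not maximality under inclusion. *)
Definition maximal (S : {fset nat}) : bool :=
  (S != fset0) && (fset_min S == #|` S|).

Definition zeckendorf (k : nat) (S : {fset nat}) : bool :=
  [forall x : S, forall y : S,
    (val x != val y) ==> (k <= `|val x - val y|)].

(* {1, ..., n} *)
Definition fset_upto (n : nat) : {fset nat} := [fset x in iota 1 n].

Definition J (k n : nat) : nat :=
  #|` [fset S in fpowerset (fset_upto n) |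
        [&& zeckendorf k S, n \in S & maximal S]]|.

(* Main.v *)
Require Import Defs.
From mathcomp Require Import all_boot.
From mathcomp Require Import finmap zify.

Set Implicit Arguments.
Unset Strict Implicit.
Unset Printing Implicit Defensive.

Local Open Scope fset_scope.
Local Open Scope nat_scope.

(** A maximal set [S] has minimum [m], its size. Let [n] be its maximum. Then [m = 1] forces [{1}],
    [m = 2] forces [{2, n}] with [n >= k + 2], and [m >= 3] leaves two gaps of length at least [k],
    so [n >= 2k + 3]. This trichotomy ([Jset_cases]) settles every [n <= 2k + 2].

    For the recurrence, let [S] have maximum [n + 1]; its other elements are at most [n + 1 - k]. If
    [n + 1 - k] is absent, the maximum can be lowered to [n] with size and minimum unchanged, which
    [move_max] undoes. If it is present, dropping [n + 1] costs one element, and shifting the rest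
    down by one restores minimum = size with maximum [n - k]; [shift_add] undoes this. So
    [Jset k n.+1] is a disjoint union of injective images of [Jset k n] and [Jset k (n - k)]
    ([Jset_rec], [card_Jset_rec]). *)

Definition Jset (k n : nat) : {fset {fset nat}} :=
  [fset S in fpowerset (fset_upto n) |
    [&& zeckendorf k S, n \in S & maximal S]].

Lemma zeckendorfP (k : nat) (S : {fset nat}) :
  reflect (forall x y, x \in S -> y \in S -> x < y -> x + k <= y)
          (zeckendorf k S).
Proof.
apply: (iffP idP) => [/forallP H x y xS yS lt_xy | H].
  have /forallP/(_ [` yS])/implyP /= := H [` xS].
  by move=> /(_ _); lia.
apply/forallP => x; apply/forallP => y; apply/implyP => ne_xy.
have := H _ _ (valP x) (valP y); have := H _ _ (valP y) (valP x).
by move: ne_xy => /=; lia.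
Qed.

(** A lower bound of [S] that belongs to [S] is its minimum, and its membership already makes [S]
    nonempty. *)
Lemma maximalP (S : {fset nat}) :
  reflect (#|` S| \in S /\ forall x, x \in S -> #|` S| <= x) (maximal S).
Proof.
apply: (iffP andP) => [[S0 /eqP <-] | [mS leS]]; first exact: fset_minP.
have S0 : S != fset0 by apply/fset0Pn; exists #|` S|.
have [minS le_min] := fset_minP S0.
by split=> //; rewrite eqn_leq le_min //= leS.
Qed.

(** Of the range [1..n] only the upper bound has to be recorded: every element is at least the size
    of [S], which is positive because [n] lies in [S]. *)
Lemma JsetP (k n : nat) (S : {fset nat}) :
  reflect [/\ n \in S, forall x, x \in S -> x <= n,
              forall x y, x \in S -> y \in S -> x < y -> x + k <= y,
              #|` S| \in S & forall x, x \in S -> #|` S| <= x]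
          (S \in Jset k n).
Proof.
rewrite !inE /=; apply: (iffP andP).
  rewrite fpowersetE => -[/fsubsetP sub].
  case/and3P => /zeckendorfP zS nS /maximalP[mS leS]; split=> // x /sub.
  by rewrite !inE mem_iota; lia.
case=> nS len zS mS leS; split; last first.
  by apply/and3P; split=> //; [apply/zeckendorfP | apply/maximalP].
have S_gt0 : 0 < #|` S| by rewrite cardfs_gt0; apply/fset0Pn; exists n.
rewrite fpowersetE; apply/fsubsetP => x xS; rewrite !inE mem_iota.
by rewrite add1n ltnS len ?andbT ?(leq_trans S_gt0) ?leS.
Qed.

Lemma Jset_cases (k n : nat) (S : {fset nat}) : S \in Jset k n ->
  [\/ n = 1 /\ S = [fset 1],
      k + 2 <= n /\ S = [fset 2; n] |
      3 <= #|` S| /\ #|` S| + 2 * k <= n].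
Proof.
case/JsetP => nS len zS mS leS.
have [eq_mn | ne_mn] := eqVneq #|` S| n.
  have S1 : S = [fset n].
    apply/fsetP => x; rewrite inE; apply/idP/eqP => [xS | -> //].
    by have := len _ xS; have := leS _ xS; lia.
  have n1 : n = 1 by rewrite -eq_mn S1 cardfs1.
  by constructor 1; split=> //; rewrite S1 n1.
have lt_mn : #|` S| < n by have := len _ mS; lia.
have zmn := zS _ _ mS nS lt_mn.
have sub2 : [fset #|` S|; n] `<=` S.
  by apply/fsubsetP => x; rewrite !inE => /orP[] /eqP ->.
have [le_S2 | nle_S2] := boolP (S `<=` [fset #|` S|; n]).
  have S2 : S = [fset #|` S|; n] by apply/eqP; rewrite eqEfsubset le_S2.
  have m2 : #|` S| = 2 by rewrite {1}S2 cardfs2 ne_mn.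
  by constructor 2; rewrite {1}S2 m2; split=> //; lia.
(* A third element [y] lies strictly between minimum and maximum, so separation applies twice and
   gives [2 * k]. *)
have /fsubsetPn[y yS] := nle_S2; rewrite !inE negb_or => /andP[ne_ym ne_yn].
have := zS _ _ mS yS; have := zS _ _ yS nS; have := leS _ yS; have := len _ yS.
move=> *; constructor 3; split; last lia.
have : y |` [fset #|` S|; n] `<=` S by rewrite fsubUset fsub1set yS.
move/fsubset_leq_card; rewrite cardfsU1 cardfs2 !inE ne_mn.
by rewrite (negPf ne_ym) (negPf ne_yn).
Qed.

(** * Values up to [2k + 2] *)

Lemma Jset1 (k : nat) : Jset k 1 = [fset [fset 1]].
Proof.
apply/fsetP => S; rewrite inE; apply/idP/eqP => [/Jset_cases | ->].
  by case=> [[_ ->] | | ] // => -[]; lia.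
by apply/JsetP; rewrite cardfs1; split=> [|x|x y||x]; rewrite ?inE; lia.
Qed.

Lemma Jset_small (k n : nat) : 2 <= n <= k + 1 -> Jset k n = fset0.
Proof.
move=> n_range; apply/fsetP => S; rewrite in_fset0; apply/negP => /Jset_cases.
by case=> -[]; lia.
Qed.

Lemma Jset_middle (k n : nat) : 0 < k -> k + 1 < n <= 2 * k + 2 ->
  Jset k n = [fset [fset 2; n]].
Proof.
move=> k_gt0 n_range; apply/fsetP => S; rewrite inE.
apply/idP/eqP => [/Jset_cases | ->].
  by case=> [|[_ ->]|] // => -[]; lia.
have c2 : #|` [fset 2; n]| = 2 by rewrite cardfs2; case: eqP => //; lia.
by apply/JsetP; rewrite c2; split=> [|x|x y||x]; rewrite ?inE; lia.
Qed.

(** * The two maps behind the recurrence *)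

Definition move_max (n : nat) (S : {fset nat}) : {fset nat} :=
  n.+1 |` (S `\ n).

(** Meant for sets with maximum [n - k]: the shift takes it to [n - k + 1], exactly [k] below the
    new element. *)
Definition shift_add (n : nat) (S : {fset nat}) : {fset nat} :=
  n.+1 |` [fset x.+1 | x in S].

Lemma mem_move_max (n x : nat) (S : {fset nat}) :
  (x \in move_max n S) = (x == n.+1) || (x != n) && (x \in S).
Proof. by rewrite !inE. Qed.

Lemma mem_shift_add (n x : nat) (S : {fset nat}) :
  (x \in shift_add n S) = (x == n.+1) || (0 < x) && (x.-1 \in S).
Proof.
rewrite !inE; congr (_ || _); apply/imfsetP/andP => /= [[y yS ->] // | ].
by case: x => [[] //|x [_ xS]]; exists x.
Qed.

Lemma card_move_max (n : nat) (S : {fset nat}) :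
  n \in S -> n.+1 \notin S -> #|` move_max n S| = #|` S|.
Proof.
move=> nS n1S; rewrite cardfsU1 !inE (negPf n1S) andbF.
by rewrite (cardfsD1 n S) nS.
Qed.

Lemma card_shift_add (n : nat) (S : {fset nat}) :
  n \notin S -> #|` shift_add n S| = #|` S|.+1.
Proof.
move=> nS; rewrite cardfsU1 card_imfset /=; last exact: succn_inj.
by rewrite (mem_imfset _ _ succn_inj) (negPf nS).
Qed.

Lemma Jset_notin (k n x : nat) (S : {fset nat}) :
  S \in Jset k n -> n < x -> x \notin S.
Proof.
by case/JsetP => _ len _ _ _ ltnx; apply/negP => /len; rewrite leqNgt ltnx.
Qed.

Lemma move_max_Jset (k n : nat) (S : {fset nat}) :
  0 < k -> 1 < n -> S \in Jset k n -> move_max n S \in Jset k n.+1.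
Proof.
move=> k_gt0 n_gt1 SJ; have n1S := Jset_notin SJ (ltnSn n).
(* The element being replaced must not be the minimum; by [Jset_cases] that would force [n = 1]. *)
have ne_mn : #|` S| != n.
  apply/eqP => mn; case: (Jset_cases SJ) => -[]; try lia.
  by move=> n_ge S2; move: mn; rewrite {1}S2 cardfs2; lia.
case/JsetP: SJ => nS len zS mS leS; apply/JsetP; rewrite card_move_max //.
split=> [|x|x y||x]; rewrite !mem_move_max ?eqxx ?mS ?ne_mn ?orbT //.
- by case/orP => [/eqP -> //|/andP[_ /len]]; lia.
- case/orP => [/eqP->|/andP[nex xS]] /orP[/eqP->|/andP[ney yS]]; try lia.
  + by have := len _ yS; lia.
  + by have := zS _ _ xS nS; have := len _ xS; lia.
  + exact: zS.
- by case/orP => [/eqP->|/andP[_ /leS] //]; have := leS _ nS; lia.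
Qed.

Lemma shift_add_Jset (k n : nat) (S : {fset nat}) :
  0 < k <= n -> S \in Jset k (n - k) -> shift_add n S \in Jset k n.+1.
Proof.
move=> kn SJ; have n1S : n \notin S by apply: (Jset_notin SJ); lia.
case/JsetP: SJ => nS len zS mS leS; apply/JsetP; rewrite card_shift_add //.
split=> [|x|x y||x]; rewrite !mem_shift_add ?eqxx ?mS ?orbT //.
- by case/orP => [/eqP -> //|/andP[_ /len]]; lia.
- case/orP => [/eqP->|/andP[x0 xS]] /orP[/eqP->|/andP[y0 yS]]; try lia.
  + by have := len _ yS; lia.
  + by have := len _ xS; lia.
  + by have := zS _ _ xS yS; lia.
- case/orP => [/eqP->|/andP[x0 /leS]]; last lia.
  by have := leS _ nS; lia.
Qed.

(** Both sets contain [n] and omit [n.+1]; at all other points the image agrees with the set. *)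
Lemma move_max_inj (k n : nat) : {in Jset k n &, injective (move_max n)}.
Proof.
move=> S T SJ TJ /fsetP eqST; apply/fsetP => x.
have := Jset_notin SJ (ltnSn n); have := Jset_notin TJ (ltnSn n).
case/JsetP: SJ => nS _ _ _ _; case/JsetP: TJ => nT _ _ _ _.
have := eqST x; rewrite !mem_move_max.
have [-> | _] := eqVneq x n; first by rewrite nS nT.
by have [-> _ /negPf-> /negPf-> | _] := eqVneq x n.+1.
Qed.

(** As [m < n], neither set contains [n], so the added [n.+1] is never confused with a shifted
    element. *)
Lemma shift_add_inj (k m n : nat) : m < n ->
  {in Jset k m &, injective (shift_add n)}.
Proof.
move=> mn S T SJ TJ /fsetP eqST; apply/fsetP => x.
have := Jset_notin SJ mn; have := Jset_notin TJ mn.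
have := eqST x.+1; rewrite !mem_shift_add eqSS /=.
by have [-> _ /negPf-> /negPf-> | _] := eqVneq x n.
Qed.

(* A set with maximum [n + 1] either omits [n + 1 - k], and then its maximum
   can be lowered by one, or contains it, and then dropping the maximum and
   shifting down by one decreases both the size and the minimum by one. *)
Lemma Jset_rec (k n : nat) : 1 < k -> 2 * k + 1 < n ->
  Jset k n.+1 = [fset move_max n S | S in Jset k n]
            `|` [fset shift_add n S | S in Jset k (n - k)].
Proof.
move=> k_gt1 n_big; apply/fsetP => S; rewrite in_fsetU.
apply/idP/orP; last first.
  case=> /imfsetP[T /= TJ ->]; first by apply: move_max_Jset => //; lia.
  by apply: shift_add_Jset => //; lia.
move=> SJ; have m_gt1 : 1 < #|` S|.
  by case: (Jset_cases SJ) => -[]; [lia | move=> _ -> | lia]; rewrite cardfs2; lia.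
(* The minimum stays below [n], so it survives the removal of [n.+1]. *)
have lt_mn : #|` S| < n.
  case: (Jset_cases SJ) => -[]; try lia.
  by move=> _ ->; rewrite cardfs2; lia.
case/JsetP: SJ => nS len zS mS leS.
(* Since [k >= 2], consecutive numbers cannot both occur; hence trading [n.+1] for [n] is
   reversible. *)
have nnS : n \notin S by apply/negP => /zS/(_ nS); lia.
have le_nk x : x \in S -> x != n.+1 -> x + k <= n.+1.
  by move=> xS ne; apply: zS => //; have := len _ xS; lia.
have [nkS | nkS] := boolP (n.+1 - k \in S); [right | left].
- pose T := [fset x.-1 | x in S `\ n.+1].
  have memT x : (x \in T) = (x != n) && (x.+1 \in S).
    apply/imfsetP/andP => /= [[y] | [xn xS]]; last first.
      by exists x.+1; rewrite // !inE eqSS xn.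
    rewrite !inE => /andP[yn yS] ->; have := leS _ yS.
    by case: y yn yS => [|y] yn yS; [lia | rewrite -eqSS].
  have ST : S = shift_add n T.
    apply/fsetP => x; rewrite mem_shift_add memT.
    have [-> | nex] /= := eqVneq x n.+1; first by rewrite nS.
    case: x nex => [_ | x nex] /=; last by rewrite -eqSS nex.
    by apply/negP => /leS; lia.
  have nT : n \notin T by rewrite memT eqxx.
  have cS : #|` S| = #|` T|.+1 by rewrite {1}ST card_shift_add.
  apply/imfsetP; exists T => //=; apply/JsetP.
  split=> [|x|x y||x]; rewrite !memT -?cS.
  + by rewrite -subSn ?nkS ?andbT; lia.
  + by case/andP => xn /le_nk; rewrite eqSS => /(_ xn); lia.
  + by case/andP => _ xS /andP[_ yS]; have := zS _ _ xS yS; lia.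
  + by rewrite mS; lia.
  + by case/andP => _ /leS; lia.
pose T := n |` (S `\ n.+1).
have memT x : (x \in T) = (x == n) || (x != n.+1) && (x \in S) by rewrite !inE.
have ST : S = move_max n T.
  apply/fsetP => x; rewrite mem_move_max memT.
  have [-> | nex] /= := eqVneq x n.+1; first by rewrite nS.
  by have [-> | _] //= := eqVneq x n; exact: negPf.
have nT : n \in T by rewrite memT eqxx.
have cS : #|` S| = #|` T|.
  by rewrite {1}ST card_move_max // memT eqxx; lia.
(* The absence of [n.+1 - k] sharpens the gap below [n.+1] by one, leaving room for [n] as the new
   maximum. *)
have lt_nk x : x \in S -> x != n.+1 -> x + k <= n.
  move=> xS ne; have := le_nk _ xS ne.
  have [|//|eqx _] := ltngtP (x + k) n.+1; first by [].
  by case/negP: nkS; rewrite -eqx addnK.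
apply/imfsetP; exists T => //=; apply/JsetP.
split=> [|x|x y||x] //; rewrite !memT -?cS.
- by case/orP => [/eqP -> //|/andP[ne /len]]; lia.
- case/orP => [/eqP->|/andP[nex xS]] /orP[/eqP->|/andP[ney yS]]; try lia.
  + by have := len _ yS; lia.
  + by move=> _; apply: lt_nk.
  + exact: zS.
- by rewrite mS; lia.
- by case/orP => [/eqP ->|/andP[_ /leS] //]; lia.
Qed.

Lemma card_Jset_rec (k n : nat) : 1 < k -> 2 * k + 1 < n ->
  #|` Jset k n.+1| = #|` Jset k n| + #|` Jset k (n - k)|.
Proof.
move=> k_gt1 n_big; rewrite Jset_rec // cardfsU.
have card_img f m : {in Jset k m &, injective f} ->
    #|` [fset f S | S : {fset nat} in Jset k m]| = #|` Jset k m|.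
  by move=> f_inj; rewrite card_in_imfset.
rewrite !card_img; [|by apply: shift_add_inj; lia|exact: move_max_inj].
set I := _ `&` _; suff -> : I = fset0 by rewrite cardfs0 subn0.
apply/fsetP => S; rewrite in_fset0 in_fsetI; apply/negP.
case/andP => /imfsetP[T /= /JsetP[nT len zT _ _] ->].
(* The point [n - k + 1] tells the images apart: it is the shifted maximum of [U], but too close to
   [n] to lie in [T]. *)
case/imfsetP => U /= /JsetP[nU _ _ _ _] /fsetP/(_ (n - k).+1).
rewrite mem_move_max mem_shift_add /= nU orbT.
case/orP => [|/andP[ne nkT]]; first lia.
by have := zT _ _ nkT nT; have := len _ nkT; lia.
Qed.

Theorem theorem6 (k : nat) (hk : 2 <= k) (n : nat) (hn : 1 <= n) :
  [/\ n = 1 -> J k n = 1,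
      2 <= n <= k + 1 -> J k n = 0,
      k + 1 < n <= 2 * k + 2 -> J k n = 1
    & 2 * k + 2 < n -> J k n = J k (n - 1) + J k (n - (k + 1))].
Proof.
rewrite -![J k _]/(#|` Jset k _|); split=> [-> | n_small | n_mid | n_big].
- by rewrite Jset1 cardfs1.
- by rewrite Jset_small // cardfs0.
- by rewrite Jset_middle ?cardfs1 //; lia.
case: n hn n_big => // n _ n_big.
by rewrite card_Jset_rec ?addn1 ?subSS ?subn0; lia.
Qed.
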